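(* Let $\mathcal{C}$ be a $J$-category in which all objects are cofibrant models. (1) Let $p:E\to B$ and $p':E'\to B$ be morphisms in $\mathcal{C}$. If $p$ admits a weak lifting along $p'$, then $\mathrm{secat}(p')\le\mathrm{secat}(p)$. (2) In particular, for every morphism $p:E\to B$ in $\mathcal{C}$, $\mathrm{secat}(p)\le\mathrm{cat}(B)$. (3) Moreover, if $p:E\to B$ admits a weak lifting along the zero morphism $0\to B$ (in particular, when $E$ is weakly contractible, i.e., $E$ and $0$ are weakly equivalent), then $\mathrm{secat}(p)=\mathrm{cat}(B)$.
   Context: **$J$-category.** A $J$-category $\mathcal{C}$ is a category with a zero object $0$ and three classes of morphisms, called fibrations, cofibrations and weak equivalences, satisfying (J1)-(J5) below. A trivial fibration (resp. trivial cofibration) is a fibration (resp. cofibration) that is also a weak equivalence. An object $B$ is a cofibrant model if every trivial fibration $E\to B$ admits a section. (J1) Isomorphisms are trivial cofibrations and trivial fibrations. Fibrations and cofibrations are closed under composition. If two of $f,g,gf$ are weak equivalences, so is the third. (J2) The pullback of a fibration $p:E\to B$ along any morphism $f:B'\to B$ exists, with projections $\overline p:E'\to B'$ and $\overline f:E'\to E$, and $\overline p$ is a fibration; if $f$ (resp. $p$) is a weak equivalence, so is $\overline f$ (resp. $\overline p$). The dual statement (pushouts of cofibrations) also holds. (J3) Every morphism $f$ has an $F$-factorization $f=p\tau$ ($\tau$ a weak equivalence, $p$ a fibration) and a $C$-factorization $f=\sigma i$ ($i$ a cofibration, $\sigma$ a weak equivalence). (J4) For every object $X$ there is a trivial fibration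 $\overline X\to X$ with $\overline X$ a cofibrant model. (J5) (Cube axiom) In any commutative cube whose bottom face is a homotopy pushout and whose vertical faces are homotopy pullbacks, the top face is a homotopy pushout. Here a commutative square with maps $D\to C$, $D\to A$, $g:C\to B$, $f:A\to B$ is a homotopy pullback if for some (equivalently any) $F$-factorization $C\to E\to B$ of $g$ the induced morphism $D\to A\times_B E$ is a weak equivalence. Homotopy pushouts are defined dually. **Weakly equivalent objects.** Two objects are weakly equivalent if they are joined by a finite zigzag of weak equivalences. **Join.** Given $f:A\to B$ and $g:C\to B$, choose an $F$-factorization $g=p\tau$, $p:E\to B$; form the pullback $E'=A\times_B E$ with projections $\overline p:E'\to A$, $\overline f:E'\to E$; choose a $C$-factorization $\overline f=\sigma i$, $i:E'\to Z$, $\sigma: Z\to E$; let $A*_BC$ be the pushout of $\overline p$ and $i$. The join morphism of $f$ and $g$ is the morphism $A*_BC\to B$ induced by $f:A\to B$ and $p\sigma:Z\to B$. It is well defined up to weak equivalence. **Weak lifting and weak section** (all objects being cofibrant models). $f:A\to B$ admits a weak lifting along $g:C\to B$ if for some (equivalently any) $F$-factorization $g=p\tau$, with $p:E\to B$, there is $s:A\to E$ with $ps=f$. A morphism $g:C\to B$ admits a weak section if $\mathrm{id}_B$ admits a weak lifting along $g$. **Sectional category.** For $p:E\to B$ define inductively $h_n:*^n_BE\to B$: $h_0=p$ (so $*^0_BE=E$), and $h_n$ is the join morphism of $h_{n-1}:*^{n-1}_BE\to B$ and $p:E\to B$ (with $*^n_BE=( *^{n-1}_BE)*_BE$). $\mathrm{secat}(p)$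 is the least integer $n\ge 0$ such that $h_n$ admits a weak section, and $\infty$ if there is no such $n$. (An equivalent Whitehead-type definition exists.) **Lusternik-Schnirelmann category.** $\mathrm{cat}(B):=\mathrm{secat}(0\to B)$. *)

(* Defs.v *)
From Stdlib Require Import Relations Classical ClassicalEpsilon PeanoNat Wf_nat.

Set Implicit Arguments.
Unset Strict Implicit.
Unset Printing Implicit Defensive.

Record category := Category {
  Ob :> Type;
  Hom : Ob -> Ob -> Type;
  idm : forall X : Ob, Hom X X;
  comp : forall X Y Z : Ob, Hom Y Z -> Hom X Y -> Hom X Z;
  comp_idl : forall (X Y : Ob) (f : Hom X Y), comp (idm Y) f = f;
  comp_idr : forall (X Y : Ob) (f : Hom X Y), comp f (idm X) = f;
  comp_assoc : forall (X Y Z T : Ob) (f : Hom X Y) (g : Hom Y Z) (h : Hom Z T),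
    comp h (comp g f) = comp (comp h g) f
}.

Arguments Hom {c} X Y : rename.
Arguments idm {c} X : rename.
Arguments comp {c X Y Z} g f : rename.

Declare Scope jcat_scope.
Delimit Scope jcat_scope with jcat.
Open Scope jcat_scope.

Notation "X ~> Y" := (Hom X Y)
  (at level 90, right associativity) : jcat_scope.
Notation "g ∘ f" := (comp g f)
  (at level 40, left associativity) : jcat_scope.

Record pointed_category := PointedCategory {
  pcat :> category;
  zero : pcat;
  from_zero : forall X : pcat, zero ~> X;
  from_zero_uniq : forall (X : pcat) (f : zero ~> X), f = from_zero X;
  to_zero : forall X : pcat, X ~> zero;
  to_zero_uniq : forall (X : pcat) (f : X ~> zero), f = to_zero X
}.

Arguments zero {p} : rename.
Arguments from_zero {p} X : rename.
Arguments to_zero {p} X : rename.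

Definition is_iso (C : category) (X Y : C) (f : X ~> Y) : Prop :=
  exists g : Y ~> X, g ∘ f = idm X /\ f ∘ g = idm Y.

(** The square [pA : P ~> A], [pE : P ~> E] over [f : A ~> B], [p : E ~> B]. *)
Definition is_pullback (C : category) (A B E P : C)
    (f : A ~> B) (p : E ~> B) (pA : P ~> A) (pE : P ~> E) : Prop :=
  f ∘ pA = p ∘ pE /\
  forall (X : C) (a : X ~> A) (e : X ~> E), f ∘ a = p ∘ e ->
    exists! u : X ~> P, pA ∘ u = a /\ pE ∘ u = e.

(** The square [jA : A ~> P], [jE : E ~> P] under [f : B ~> A], [i : B ~> E]. *)
Definition is_pushout (C : category) (A B E P : C)
    (f : B ~> A) (i : B ~> E) (jA : A ~> P) (jE : E ~> P) : Prop :=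
  jA ∘ f = jE ∘ i /\
  forall (X : C) (a : A ~> X) (e : E ~> X), a ∘ f = e ∘ i ->
    exists! u : P ~> X, u ∘ jA = a /\ u ∘ jE = e.

Record fcw_category := FcwCategory {
  fcw_cat :> pointed_category;
  fib : forall X Y : fcw_cat, (X ~> Y) -> Prop;
  cof : forall X Y : fcw_cat, (X ~> Y) -> Prop;
  weq : forall X Y : fcw_cat, (X ~> Y) -> Prop
}.

Arguments fib {f X Y} _ : rename.
Arguments cof {f X Y} _ : rename.
Arguments weq {f X Y} _ : rename.

Section Notions.
Variable C : fcw_category.

Definition trivial_fib (X Y : C) (f : X ~> Y) : Prop := fib f /\ weq f.
Definition trivial_cof (X Y : C) (f : X ~> Y) : Prop := cof f /\ weq f.

Definition cofibrant_model (B : C) : Prop :=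
  forall (E : C) (p : E ~> B), trivial_fib p ->
    exists s : B ~> E, p ∘ s = idm B.

Definition F_factorization (X Y E : C) (f : X ~> Y)
    (t : X ~> E) (p : E ~> Y) : Prop :=
  weq t /\ fib p /\ f = p ∘ t.

Definition C_factorization (X Y Z : C) (f : X ~> Y)
    (i : X ~> Z) (s : Z ~> Y) : Prop :=
  cof i /\ weq s /\ f = s ∘ i.

(** The commutative square
<<
      D --u--> C0
      |        |
      v        g
      |        |
      A --f--> B
>>
    is a homotopy pullback; [w] is the induced morphism from [D] to the
    pullback [P] of [f] and [p]. *)
Definition homotopy_pullback (A B C0 D : C)
    (u : D ~> C0) (v : D ~> A) (g : C0 ~> B) (f : A ~> B) : Prop :=
  g ∘ u = f ∘ v /\
  exists (E : C) (t : C0 ~> E) (p : E ~> B),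
    F_factorization g t p /\
  exists (P : C) (pA : P ~> A) (pE : P ~> E),
    is_pullback f p pA pE /\
  exists w : D ~> P, pA ∘ w = v /\ pE ∘ w = t ∘ u /\ weq w.

(** The commutative square
<<
      B --f--> A
      |        |
      g        v
      |        |
      C0 -u--> D
>>
    is a homotopy pushout; [w] is the induced morphism to [D] from the
    pushout [P] of [f] and [i]. *)
Definition homotopy_pushout (A B C0 D : C)
    (u : C0 ~> D) (v : A ~> D) (g : B ~> C0) (f : B ~> A) : Prop :=
  u ∘ g = v ∘ f /\
  exists (Z : C) (i : B ~> Z) (s : Z ~> C0),
    C_factorization g i s /\
  exists (P : C) (jA : A ~> P) (jZ : Z ~> P),
    is_pushout f i jA jZ /\
  exists w : P ~> D, w ∘ jA = v /\ w ∘ jZ = u ∘ s /\ weq w.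

(** Primed objects form the top face, unprimed ones the bottom face; the
    commutativity of the five faces other than the top one is part of
    [homotopy_pushout] and [homotopy_pullback]. *)
Definition cube_axiom : Prop :=
  forall (X00 X01 X10 X11 Y00 Y01 Y10 Y11 : C)
    (* bottom face *)
    (f0 : X00 ~> X01) (g0 : X00 ~> X10) (f1 : X10 ~> X11) (g1 : X01 ~> X11)
    (* top face *)
    (f0' : Y00 ~> Y01) (g0' : Y00 ~> Y10) (f1' : Y10 ~> Y11) (g1' : Y01 ~> Y11)
    (* vertical edges *)
    (v00 : Y00 ~> X00) (v01 : Y01 ~> X01) (v10 : Y10 ~> X10) (v11 : Y11 ~> X11),
  g1' ∘ f0' = f1' ∘ g0' ->
  homotopy_pushout g1 f1 f0 g0 ->
  homotopy_pullback f0' v00 v01 f0 ->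
  homotopy_pullback g0' v00 v10 g0 ->
  homotopy_pullback f1' v10 v11 f1 ->
  homotopy_pullback g1' v01 v11 g1 ->
  homotopy_pushout g1' f1' f0' g0'.

Record J_category : Prop := {
  J1_iso : forall (X Y : C) (f : X ~> Y), is_iso f ->
    trivial_cof f /\ trivial_fib f;
  J1_fib_comp : forall (X Y Z : C) (f : X ~> Y) (g : Y ~> Z),
    fib f -> fib g -> fib (g ∘ f);
  J1_cof_comp : forall (X Y Z : C) (f : X ~> Y) (g : Y ~> Z),
    cof f -> cof g -> cof (g ∘ f);
  J1_weq_comp : forall (X Y Z : C) (f : X ~> Y) (g : Y ~> Z),
    weq f -> weq g -> weq (g ∘ f);
  J1_weq_cancel_l : forall (X Y Z : C) (f : X ~> Y) (g : Y ~> Z),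
    weq g -> weq (g ∘ f) -> weq f;
  J1_weq_cancel_r : forall (X Y Z : C) (f : X ~> Y) (g : Y ~> Z),
    weq f -> weq (g ∘ f) -> weq g;

  J2_pullback : forall (E B B' : C) (p : E ~> B) (f : B' ~> B), fib p ->
    exists (E' : C) (p' : E' ~> B') (f' : E' ~> E), is_pullback f p p' f';
  J2_pullback_fib : forall (E B B' E' : C) (p : E ~> B) (f : B' ~> B)
      (p' : E' ~> B') (f' : E' ~> E),
    fib p -> is_pullback f p p' f' ->
    fib p' /\ (weq f -> weq f') /\ (weq p -> weq p');
  J2_pushout : forall (E B B' : C) (i : B ~> E) (f : B ~> B'), cof i ->
    exists (E' : C) (i' : B' ~> E') (f' : E ~> E'), is_pushout f i i' f';
  J2_pushout_cof : forall (E B B' E' : C) (i : B ~> E) (f : B ~> B')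
      (i' : B' ~> E') (f' : E ~> E'),
    cof i -> is_pushout f i i' f' ->
    cof i' /\ (weq f -> weq f') /\ (weq i -> weq i');

  J3_F : forall (X Y : C) (f : X ~> Y),
    exists (E : C) (t : X ~> E) (p : E ~> Y), F_factorization f t p;
  J3_C : forall (X Y : C) (f : X ~> Y),
    exists (Z : C) (i : X ~> Z) (s : Z ~> Y), C_factorization f i s;

  J4 : forall X : C, exists (X' : C) (q : X' ~> X),
    trivial_fib q /\ cofibrant_model X';

  J5 : cube_axiom
}.

Definition weakly_equivalent : C -> C -> Prop :=
  clos_refl_sym_trans C (fun X Y => exists w : X ~> Y, weq w).

Definition weakly_contractible (X : C) : Prop := weakly_equivalent X zero.

(** A join depends on choices of factorizations, pullback and pushout, so it
    is given as a relation: [k : J ~> B] is a join morphism of [f] and [g]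
    for some such choices. *)
Definition is_join (A B C0 J : C)
    (f : A ~> B) (g : C0 ~> B) (k : J ~> B) : Prop :=
  exists (E : C) (t : C0 ~> E) (p : E ~> B),
    F_factorization g t p /\
  exists (E' : C) (p' : E' ~> A) (f' : E' ~> E),
    is_pullback f p p' f' /\
  exists (Z : C) (i : E' ~> Z) (s : Z ~> E),
    C_factorization f' i s /\
  exists (jA : A ~> J) (jZ : Z ~> J),
    is_pushout p' i jA jZ /\
    k ∘ jA = f /\ k ∘ jZ = p ∘ s.

(** [is_iterated_join p n h] : [h] is an [n]-th iterated join morphism [h_n]
    of [p]. *)
Inductive is_iterated_join (E B : C) (p : E ~> B) :
    nat -> forall X : C, (X ~> B) -> Prop :=
| iterated_join_0 : is_iterated_join p 0 p
| iterated_join_S (n : nat) (X Y : C) (h : X ~> B) (k : Y ~> B) :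
    is_iterated_join p n h -> is_join h p k -> is_iterated_join p (S n) k.

Definition weak_lifting (A B C0 : C) (f : A ~> B) (g : C0 ~> B) : Prop :=
  exists (E : C) (t : C0 ~> E) (p : E ~> B),
    F_factorization g t p /\ exists s : A ~> E, p ∘ s = f.

Definition weak_section (B C0 : C) (g : C0 ~> B) : Prop :=
  weak_lifting (idm B) g.

Definition secat_cond (E B : C) (p : E ~> B) (n : nat) : Prop :=
  exists (X : C) (h : X ~> B), is_iterated_join p n h /\ weak_section h.

End Notions.

(** Values in the natural numbers extended by infinity, which is [None]. *)
Definition is_least (P : nat -> Prop) (v : option nat) : Prop :=
  match v with
  | Some n => P n /\ forall m, P m -> n <= m
  | None => forall n, ~ P n
  end.

Definition least (P : nat -> Prop) : option nat :=
  epsilon (inhabits None) (is_least P).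

Lemma leastP (P : nat -> Prop) : is_least P (least P).
Proof.
unfold least; apply epsilon_spec.
destruct (classic (exists n, P n)) as [exP|nexP].
- destruct (dec_inh_nat_subset_has_unique_least_element P
              (fun n => classic (P n)) exP) as [n [[Pn leP] _]].
  exists (Some n); split; assumption.
- exists None; intros n Pn; apply nexP; exists n; exact Pn.
Qed.

Definition le_infty (m n : option nat) : Prop :=
  match m, n with
  | _, None => True
  | None, Some _ => False
  | Some a, Some b => a <= b
  end.

Definition secat (C : fcw_category) (E B : C) (p : E ~> B) : option nat :=
  least (secat_cond p).

Definition LScat (C : fcw_category) (B : C) : option nat :=
  secat (from_zero B).

(* Main.v *)
From Stdlib Require Import PeanoNat.
Require Import Defs.

Set Implicit Arguments.
Unset Strict Implicit.
Unset Printing Implicit Defensive.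

(** Weak liftings are controlled by one extension property: a morphism over [B]
    into a fibration extends over [B] along any weak equivalence [t : X ~> Y],
    though not compatibly with [t]. Indeed, factoring [X ~> Y ×_B E] into a weak
    equivalence followed by a fibration yields a trivial fibration over [Y],
    which has a section because [Y] is a cofibrant model. Consequently weak
    liftings compose.

    The join is moreover monotone for the weak lifting relation: the
    C-factorization in a join can be enlarged so as to receive both the chosen
    factorization of the first join and that of the second, and the enlarged
    join is still weakly equivalent to the second one. By induction the iterated
    joins of [p] lift weakly along suitable iterated joins of [p'], and a weak
    section of the former gives one of the latter. Finally, if [E] is weakly
    contractible then [0 ~> E] is a weak equivalence, and the extension property
    provides the weak lifting along [0 ~> B]. *)

Lemma least_le (P Q : nat -> Prop) :
  (forall n, P n -> Q n) -> le_infty (least Q) (least P).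
Proof.
intros PQ; pose proof (leastP P) as HP; pose proof (leastP Q) as HQ.
destruct (least P) as [n|], (least Q) as [m|]; simpl in *; auto.
- apply HQ, PQ, HP.
- exact (HQ n (PQ n (proj1 HP))).
Qed.

Lemma le_infty_antisym (m n : option nat) :
  le_infty m n -> le_infty n m -> m = n.
Proof.
destruct m, n; simpl; intros mn nm; try contradiction; auto.
f_equal; apply Nat.le_antisymm; assumption.
Qed.

Section Limits.
Variable C : category.

Lemma pullback_lift (A B E P : C) (f : A ~> B) (p : E ~> B) (pA : P ~> A)
    (pE : P ~> E) (X : C) (a : X ~> A) (e : X ~> E) :
  is_pullback f p pA pE -> f ∘ a = p ∘ e ->
  exists u : X ~> P, pA ∘ u = a /\ pE ∘ u = e.
Proof. intros [_ H] fa; destruct (H X a e fa) as [u [Hu _]]; exists u; exact Hu. Qed.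

Lemma pushout_desc (A B E P : C) (f : B ~> A) (i : B ~> E) (jA : A ~> P)
    (jE : E ~> P) (X : C) (a : A ~> X) (e : E ~> X) :
  is_pushout f i jA jE -> a ∘ f = e ∘ i ->
  exists u : P ~> X, u ∘ jA = a /\ u ∘ jE = e.
Proof. intros [_ H] fa; destruct (H X a e fa) as [u [Hu _]]; exists u; exact Hu. Qed.

Lemma pushout_ext (A B E P : C) (f : B ~> A) (i : B ~> E) (jA : A ~> P)
    (jE : E ~> P) (X : C) (u v : P ~> X) :
  is_pushout f i jA jE -> u ∘ jA = v ∘ jA -> u ∘ jE = v ∘ jE -> u = v.
Proof.
intros [sq H] uA uE.
destruct (H X (v ∘ jA) (v ∘ jE)) as [w [_ Hw]].
  rewrite <- !comp_assoc, sq; reflexivity.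
rewrite <- (Hw u (conj uA uE)); apply Hw; split; reflexivity.
Qed.

(** Serves to compute the pullback in a join in two stages, along the fibration and then along the
    weak equivalence of an F-factorization. *)
Lemma pullback_paste (A A' B E P P' : C) (f : A ~> B) (p : E ~> B)
    (pA : P ~> A) (pE : P ~> E) (s : A' ~> A) (pA' : P' ~> A') (w : P' ~> P) :
  is_pullback f p pA pE -> is_pullback s pA pA' w ->
  is_pullback (f ∘ s) p pA' (pE ∘ w).
Proof.
intros [sq H] [sq' H']; split.
  rewrite <- comp_assoc, sq', !comp_assoc, sq; reflexivity.
intros X a e fa.
destruct (H X (s ∘ a) e) as [u [[uA uE] Hu]].
  rewrite comp_assoc; exact fa.
destruct (H' X a u (eq_sym uA)) as [v [[vA vP] Hv]].
exists v; split.
  split; [exact vA | rewrite <- comp_assoc, vP; exact uE].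
intros v' [v'A v'E]; apply Hv; split; [exact v'A|].
symmetry; apply Hu; split.
  rewrite comp_assoc, <- sq', <- comp_assoc, v'A; reflexivity.
rewrite comp_assoc; exact v'E.
Qed.

End Limits.

Section JCategory.
Variable C : fcw_category.
Hypothesis HJ : J_category C.
Hypothesis Hcm : forall X : C, cofibrant_model X.

Lemma extend_along_weq (B E X Y : C) (p : E ~> B) (t : X ~> Y) (q : Y ~> B)
    (l : X ~> E) :
  fib p -> weq t -> q ∘ t = p ∘ l -> exists m : Y ~> E, p ∘ m = q.
Proof.
intros fp wt sq.
destruct (J2_pullback HJ q fp) as [P [pY [pE HP]]].
destruct (J2_pullback_fib HJ fp HP) as [fpY _].
destruct (pullback_lift HP sq) as [u [uY uE]].
destruct (J3_F HJ u) as [W [s [r [ws [fr ur]]]]].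
assert (tf : trivial_fib (pY ∘ r)).
  split; [exact (J1_fib_comp HJ fr fpY)|].
  apply (J1_weq_cancel_r HJ ws).
  rewrite <- comp_assoc, <- ur, uY; exact wt.
destruct (Hcm tf) as [j Hj].
exists (pE ∘ r ∘ j).
rewrite !comp_assoc, <- (proj1 HP), <- !comp_assoc, (comp_assoc j), Hj.
apply comp_idr.
Qed.

(** A criterion in which [g'] need not be a fibration: extending along [w] carries [g'] into an
    F-factorization of [g]. *)
Lemma weak_lifting_of_weq (B X Y Y' : C) (f : X ~> B) (g : Y ~> B)
    (g' : Y' ~> B) (a : X ~> Y') (w : Y ~> Y') :
  weq w -> g' ∘ w = g -> g' ∘ a = f -> weak_lifting f g.
Proof.
intros ww gw ga.
destruct (J3_F HJ g) as [E [t [p [wt [fp gpt]]]]].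
destruct (@extend_along_weq B E Y Y' p w g' t fp ww) as [m Hm].
  rewrite gw; exact gpt.
exists E, t, p; split; [repeat split; assumption|].
exists (m ∘ a); rewrite comp_assoc, Hm; exact ga.
Qed.

(** The lifting [l] of [g] extends along [t] to the object [E] that replaces [Y], where it can be
    composed with [s]. *)
Lemma weak_lifting_trans (B X Y Z : C) (f : X ~> B) (g : Y ~> B) (h : Z ~> B) :
  weak_lifting f g -> weak_lifting g h -> weak_lifting f h.
Proof.
intros [E [t [p [[wt [_ gpt]] [s Hs]]]]] [R [u [r [[wu [fr hru]] [l Hl]]]]].
destruct (@extend_along_weq B R Y E r t p l fr wt) as [m Hm].
  rewrite Hl; symmetry; exact gpt.
exists R, u, r; split; [repeat split; assumption|].
exists (m ∘ s); rewrite comp_assoc, Hm; exact Hs.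
Qed.

Lemma join_weak_lifting (B A A' G G' J : C) (f : A ~> B) (f' : A' ~> B)
    (g : G ~> B) (g' : G' ~> B) (k : J ~> B) :
  weak_lifting f f' -> weak_lifting g g' -> is_join f g k ->
  exists (J' : C) (k' : J' ~> B), is_join f' g' k' /\ weak_lifting k k'.
Proof.
intros [R [s [r [[ws [fr f'rs]] [a ra]]]]].
intros [E' [t' [p' [[wt' [fp' g'pt]] [l pl]]]]].
intros [E [t [p [[wt [fp gpt]] [D [dA [dE [HD
  [Z [i [z [[ci [wz dEzi]] [jA [jZ [HJn [kA kZ]]]]]]]]]]]]]]]].
destruct (@extend_along_weq B E' G E p' t p l fp' wt) as [m Hm].
  rewrite pl; symmetry; exact gpt.
(* The pullback of [p'] along [f' = r ∘ s] is built through [D2], since [a] lands in [R] and not in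
   [A']. The comparison [w] is a base change of [s] along the fibration [dR], hence a weak
   equivalence. *)
destruct (J2_pullback HJ r fp') as [D2 [dR [dE2 HD2]]].
destruct (J2_pullback_fib HJ fp' HD2) as [fdR _].
destruct (J2_pullback HJ s fdR) as [D' [dA' [w HD']]].
destruct (J2_pullback_fib HJ fdR HD') as [_ [ww _]]; specialize (ww ws).
pose proof (pullback_paste HD2 HD') as HD'B; rewrite <- f'rs in HD'B.
destruct (J3_C HJ (dE2 ∘ w)) as [Z0 [i0 [z0 [ci0 [wz0 e0]]]]].
destruct (J2_pushout HJ dA' ci0) as [J' [jA' [jZ0 HJ']]].
destruct (J2_pushout_cof HJ ci0 HJ') as [cjA' _].
destruct (@pushout_desc C _ _ _ _ _ _ _ _ B f' (p' ∘ z0) HJ') as [k' [k'A k'Z]].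
  rewrite (proj1 HD'B), e0; apply comp_assoc.
exists J', k'; split.
  exists E', t', p'; split; [repeat split; assumption|].
  exists D', dA', (dE2 ∘ w); split; [exact HD'B|].
  exists Z0, i0, z0; split; [repeat split; assumption|].
  exists jA', jZ0; repeat split; try assumption; apply HJ'.
(* [JQ] is the join of [r] and [g'] computed from the C-factorization of
   [dE2 : D2 ~> E'] through [Q]. *)
destruct (J2_pushout HJ w ci0) as [Q [jD [jQ HQ]]].
destruct (J2_pushout_cof HJ ci0 HQ) as [_ [wjQ _]]; specialize (wjQ ww).
destruct (pushout_desc HQ e0) as [q [qD qZ]].
assert (wq : weq q) by (apply (J1_weq_cancel_r HJ wjQ); rewrite qZ; exact wz0).
(* Taking [JQ] as a pushout of [J'] along [s] makes the comparison [v] from [J'] a weak equivalence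
   at once. *)
destruct (J2_pushout HJ s cjA') as [JQ [jR [v HJQ]]].
destruct (J2_pushout_cof HJ cjA' HJQ) as [_ [wv _]]; specialize (wv ws).
destruct (@pushout_desc C _ _ _ _ _ _ _ _ B r k' HJQ) as [kQ [kQR kQv]].
  rewrite k'A; symmetry; exact f'rs.
destruct (@pushout_desc C _ _ _ _ _ _ _ _ JQ (jR ∘ dR) (v ∘ jZ0) HQ)
  as [y [yD yZ]].
  rewrite <- !comp_assoc, <- (proj1 HD'), <- (proj1 HJ'), !comp_assoc.
  rewrite (proj1 HJQ); reflexivity.
(* [Z2] enlarges [Q] so that it also receives [Z]. *)
destruct (@pullback_lift C _ _ _ _ _ _ _ _ D (a ∘ dA) (m ∘ dE) HD2)
  as [d [dRd dEd]].
  rewrite !comp_assoc, ra, Hm; exact (proj1 HD).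
destruct (J2_pushout HJ (jD ∘ d) ci) as [T [jQT [jZT HT]]].
destruct (J2_pushout_cof HJ ci HT) as [cjQT _].
destruct (@pushout_desc C _ _ _ _ _ _ _ _ E' q (m ∘ z) HT) as [x [xQ xZ]].
  rewrite comp_assoc, qD, dEd, <- comp_assoc, <- dEzi; reflexivity.
destruct (J3_C HJ x) as [Z2 [i2 [z2 [ci2 [wz2 xzi]]]]].
pose proof (J1_cof_comp HJ cjQT ci2) as cQ2.
assert (z2Q : z2 ∘ (i2 ∘ jQT) = q) by (rewrite comp_assoc, <- xzi; exact xQ).
(* Enlarging [Q] to [Z2] keeps the homotopy type because both map to [E'] by weak equivalences;
   pushing out the resulting trivial cofibration gives a weak equivalence from [JQ] to [J2]. *)
assert (wQ2 : weq (i2 ∘ jQT)).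
  apply (J1_weq_cancel_l HJ wz2); rewrite z2Q; exact wq.
destruct (J2_pushout HJ y cQ2) as [J2 [jJQ [jZ2 HJ2]]].
destruct (J2_pushout_cof HJ cQ2 HJ2) as [_ [_ wjJQ]]; specialize (wjJQ wQ2).
destruct (@pushout_desc C _ _ _ _ _ _ _ _ B kQ (p' ∘ z2) HJ2) as [k2 [k2J k2Z]].
  rewrite <- comp_assoc, z2Q; apply (pushout_ext HQ).
    rewrite <- !comp_assoc, yD, qD, comp_assoc, kQR; exact (proj1 HD2).
  rewrite <- !comp_assoc, yZ, qZ, comp_assoc, kQv; exact k'Z.
destruct (@pushout_desc C _ _ _ _ _ _ _ _ J2 (jJQ ∘ (jR ∘ a)) (jZ2 ∘ (i2 ∘ jZT))
  HJn) as [b [bA bZ]].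
  rewrite <- !comp_assoc, <- (proj1 HT), <- dRd, (comp_assoc d dR jR), <- yD.
  rewrite !comp_assoc, (proj1 HJ2), !comp_assoc; reflexivity.
(* Over [B], [J] maps to [J2] by [b], and [J'] maps to [J2] by a weak equivalence through [JQ]. *)
apply (@weak_lifting_of_weq B J J' J2 k k' k2 b (jJQ ∘ v)).
- exact (J1_weq_comp HJ wv wjJQ).
- rewrite comp_assoc, k2J; exact kQv.
- apply (pushout_ext HJn).
    rewrite <- comp_assoc, bA, !comp_assoc, k2J, kQR, ra; symmetry; exact kA.
  rewrite <- comp_assoc, bZ, !comp_assoc, k2Z, <- (comp_assoc i2), <- xzi.
  rewrite <- comp_assoc, xZ, comp_assoc, Hm; symmetry; exact kZ.
Qed.

Lemma iterated_join_weak_lifting (B E E' : C) (p : E ~> B) (p' : E' ~> B)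
    (n : nat) (X : C) (h : X ~> B) :
  weak_lifting p p' -> is_iterated_join p n h ->
  exists (X' : C) (h' : X' ~> B), is_iterated_join p' n h' /\ weak_lifting h h'.
Proof.
intros pp' Hh; induction Hh as [|n X Y h k _ [X' [h' [Hh' hh']]] Hk].
  exists E', p'; split; [constructor | exact pp'].
destruct (join_weak_lifting hh' pp' Hk) as [J' [k' [Hk' kk']]].
exists J', k'; split; [exact (iterated_join_S Hh' Hk') | exact kk'].
Qed.

Lemma secat_cond_weak_lifting (B E E' : C) (p : E ~> B) (p' : E' ~> B) (n : nat) :
  weak_lifting p p' -> secat_cond p n -> secat_cond p' n.
Proof.
intros pp' [X [h [Hh sh]]].
destruct (iterated_join_weak_lifting pp' Hh) as [X' [h' [Hh' hh']]].
exists X', h'; split; [exact Hh' | exact (weak_lifting_trans sh hh')].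
Qed.

Lemma secat_weak_lifting (B E E' : C) (p : E ~> B) (p' : E' ~> B) :
  weak_lifting p p' -> le_infty (secat p') (secat p).
Proof.
intros pp'; apply least_le; intros n; exact (secat_cond_weak_lifting pp').
Qed.

Lemma id_weq (X : C) : weq (idm X).
Proof.
apply (J1_iso HJ); exists (idm X); split; apply comp_idl.
Qed.

(** [from_zero E] is already a strict lifting, because [zero] is initial. *)
Lemma from_zero_weak_lifting (B E : C) (p : E ~> B) :
  weak_lifting (from_zero B) p.
Proof.
apply (@weak_lifting_of_weq B zero E E _ p p (from_zero E) _ (id_weq E)
  (comp_idr p)).
apply from_zero_uniq.
Qed.

(** For each link [w] of the zigzag, [to_zero Y ∘ w] is [to_zero X], so two-out-of-three applies. *)
Lemma weakly_equivalent_to_zero (X Y : C) :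
  weakly_equivalent X Y -> (weq (to_zero X) <-> weq (to_zero Y)).
Proof.
induction 1 as [X Y [w ww]|X|X Y _ IH|X Y Z _ IH1 _ IH2]; try tauto.
rewrite <- (to_zero_uniq (to_zero Y ∘ w)); split; intros H.
- exact (J1_weq_cancel_r HJ ww H).
- exact (J1_weq_comp HJ ww H).
Qed.

(** Both [to_zero X] and the composite [to_zero X ∘ from_zero X], an identity, are weak
    equivalences; this turns an arbitrary zigzag into a single morphism over which to extend. *)
Lemma contractible_from_zero_weq (X : C) :
  weakly_contractible X -> weq (from_zero X).
Proof.
intros H.
assert (id0 : to_zero (zero (p := C)) = idm zero)
  by (symmetry; apply to_zero_uniq).
apply (J1_weq_cancel_l HJ (g := to_zero X)).
- apply (weakly_equivalent_to_zero H); rewrite id0; apply id_weq.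
- rewrite (to_zero_uniq (to_zero X ∘ from_zero X)), id0; apply id_weq.
Qed.

Lemma contractible_weak_lifting (B E : C) (p : E ~> B) :
  weakly_contractible E -> weak_lifting p (from_zero B).
Proof.
intros H; apply (weak_lifting_of_weq (contractible_from_zero_weq H)
  (from_zero_uniq (p ∘ from_zero E)) (comp_idr p)).
Qed.

End JCategory.

Theorem theorem22 (C : fcw_category) (HJ : J_category C)
    (Hcm : forall X : C, cofibrant_model X) :
  (forall (B E E' : C) (p : E ~> B) (p' : E' ~> B),
     weak_lifting p p' -> le_infty (secat p') (secat p)) /\
  (forall (B E : C) (p : E ~> B), le_infty (secat p) (LScat B)) /\
  (forall (B E : C) (p : E ~> B),
     (weak_lifting p (from_zero B) -> secat p = LScat B) /\
     (weakly_contractible E ->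
        weak_lifting p (from_zero B) /\ secat p = LScat B)).
Proof.
assert (le_cat : forall (B E : C) (p : E ~> B), le_infty (secat p) (LScat B)).
  intros B E p; exact (secat_weak_lifting HJ Hcm (from_zero_weak_lifting HJ Hcm p)).
assert (eq_cat : forall (B E : C) (p : E ~> B),
    weak_lifting p (from_zero B) -> secat p = LScat B).
  intros B E p Hp; apply le_infty_antisym; [apply le_cat|].
  exact (secat_weak_lifting HJ Hcm Hp).
split; [exact (@secat_weak_lifting C HJ Hcm) | split; [exact le_cat|]].
intros B E p; split; [apply eq_cat|].
intros HE; pose proof (contractible_weak_lifting HJ Hcm p HE) as Hp.
split; [exact Hp | exact (eq_cat B E p Hp)].
Qed.
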